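(* The spectrum of a $\sigma$-shift acting on a smooth Banach space is the whole unit circle. That is, if $(\mathbb{Y},\|\cdot\|_{\mathbb{Y}})$ is a nonzero smooth complex Banach space and $\widetilde{V}:\mathbb{Y}\to\mathbb{Y}$ is a $\sigma$-shift on it, then $\sigma(\widetilde{V})=\mathbb{T}=\{\lambda\in\mathbb{C}:|\lambda|=1\}$.
   Context: A Banach space is smooth if every nonzero $x$ has exactly one $f$ in the dual with $\|f\|=\|x\|$ and $f(x)=\|x\|^2$. $x\perp_B y$ means $\|x+\lambda y\|\ge\|x\|$ for all $\lambda\in\mathbb{C}$; for subspaces it is required for all pairs of elements. A $\sigma$-shift on $(\mathbb{Y},\|\cdot\|_{\mathbb{Y}})$ (the case of the paper's definition in which the domain norm $\|\cdot\|_\sigma$ and range norm $\|\cdot\|_{\mathbb{Y}}$ coincide) is a surjective linear isometry $\widetilde{V}$ of $\mathbb{Y}$ for which there is a closed linear subspace $\mathcal{I}$ such that: (i) $\widetilde{V}^n\mathcal{I}\perp_B\mathcal{I}$ for $n=1,2,\dots$ and $\mathcal{I}\perp_B\widetilde{V}^n\mathcal{I}$ for $n=-1,-2,\dots$; (ii) $(\mathbb{Y},\|\cdot\|_{\mathbb{Y}})=(\mathbb{W},\|\cdot\|_{\mathbb{W}})$, where $\mathbb{W}=\{w_1+w_2: w_1\in\bigoplus_{n=0}^\infty\widetilde{V}^n\mathcal{I},\ w_2\in\bigoplus_{n=-\infty}^{-1}\widetilde{V}^n\mathcal{I}\}$ and $\|w_1+w_2\|_{\mathbb{W}}=(\|w_1\|_{\mathbb{Y}}^2+\|w_2\|_{\mathbb{Y}}^2)^{1/2}$.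 Here $\bigoplus_{n=0}^\infty\widetilde{V}^n\mathcal{I}$ (resp. $\bigoplus_{n=-\infty}^{-1}\widetilde{V}^n\mathcal{I}$) is the set of elements uniquely expressible as a convergent series $\sum_{n=0}^\infty\widetilde{V}^nl_n$ (resp. $\sum_{n=1}^\infty\widetilde{V}^{-n}l_{-n}$) with $l_n\in\mathcal{I}$. *)

(* Defs.v *)
From HB Require Import structures.
From mathcomp Require Import all_boot all_order all_algebra.
From mathcomp Require Import complex.
From mathcomp Require Import all_classical all_reals all_analysis.
Set Implicit Arguments.
Unset Strict Implicit.
Unset Printing Implicit Defensive.
Import Order.TTheory GRing.Theory Num.Theory.
Import numFieldNormedType.Exports.
Local Open Scope classical_set_scope.
Local Open Scope ring_scope.
Local Open Scope complex_scope.

(* The norm of a normed module over R[i] takes its values in R[i]; it is a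
   nonnegative real there, and comparisons in R[i] relate only numbers with
   the same imaginary part. *)

Section Defs.
Context (R : realType) (Y : completeNormedModType R[i]).
Implicit Types (x y : Y) (A B I : set Y) (V T : Y -> Y) (f : Y -> (R[i] : numFieldType)^o).

Definition dual : set (Y -> (R[i] : numFieldType)^o) :=
  [set f : Y -> (R[i] : numFieldType)^o | scalar f /\ continuous f].

(* The suprema of realType live in R, hence the real part. *)
Definition dual_norm f : R :=
  sup [set complex.Re `|f x| | x in [set x : Y | `|x| <= 1]].

Definition smooth : Prop :=
  forall x, x != 0 ->
    exists! f, [/\ dual f, (dual_norm f)%:C = `|x| & f x = `|x| ^+ 2].

Definition birkhoff_orthogonal x y : Prop :=
  forall lambda : R[i], `|x| <= `|x + lambda *: y|.

Definition birkhoff_orthogonal_sets A B : Prop :=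
  forall x y, A x -> B y -> birkhoff_orthogonal x y.

Definition closed_subspace I : Prop :=
  [/\ I 0,
      forall (a : R[i]) x y, I x -> I y -> I (a *: x + y)
    & closed I].

Definition surjective_linear_isometry V : Prop :=
  [/\ linear V, forall x, `|V x| = `|x| & set_surj [set: Y] [set: Y] V].

(* V ^ n for integers n; 'pinv_(fun=> 0) setT V is the inverse of V when V is
   bijective, as surjective linear isometries are. *)
Definition zpow V (n : int) : Y -> Y :=
  match n with
  | Posz k => iter k V
  | Negz k => iter k.+1 ('pinv_(fun=> 0) [set: Y] V)
  end.

(* The elements that are the sum of sum_(n >= 0) V ^ (e n) (l n) for one and
   only one sequence l in I. *)
Definition unique_series_span V I (e : nat -> int) : set Y :=
  [set y | exists! l : nat -> Y,
    (forall n, I (l n)) /\ series (fun n => zpow V (e n) (l n)) @ \oo --> y].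

Definition forward_sum V I : set Y :=
  unique_series_span V I (fun n => n%:Z).

(* The coefficient of V ^ -(n + 1) has index n. *)
Definition backward_sum V I : set Y :=
  unique_series_span V I (fun n => - n.+1%:Z).

Definition sigma_shift V : Prop :=
  surjective_linear_isometry V /\
  exists I : set Y, closed_subspace I /\
  [/\ forall n : int, 0 < n -> birkhoff_orthogonal_sets (zpow V n @` I) I,
      forall n : int, n < 0 -> birkhoff_orthogonal_sets I (zpow V n @` I),
      [set w1 + w2 | w1 in forward_sum V I & w2 in backward_sum V I] = [set: Y]
    & forall w1 w2, forward_sum V I w1 -> backward_sum V I w2 ->
        `|w1 + w2| = sqrtC (`|w1| ^+ 2 + `|w2| ^+ 2)].

Definition boundedly_invertible T : Prop :=
  exists S : {linear Y -> Y}, [/\ continuous S, cancel T S & cancel S T].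

Definition spectrum T : set R[i] :=
  [set lambda | ~ boundedly_invertible (fun x => lambda *: x - T x)].

End Defs.

Arguments smooth {R} Y.

(* Main.v *)
(* If V is a sigma-shift with subspace I, the decomposition of Y shows that the
   forward and backward sums are inhabited, hence that series expansions
   sum V ^ n (l n) with l in I are unique whenever they converge.  Finite sums
   are therefore forward (or backward) sums.  For l <> 0 in I and
   |lambda| = 1, put x N = sum_(n < N) lambda ^- n V ^ n l.  As
   V^-1 (x N.+1) = lambda^-1 (x N) + V^-1 l is the sum of a forward and a
   backward sum, |x N| ^ 2 = N |l| ^ 2, whereas (lambda - V) (x N) telescopes
   to lambda (l - lambda ^- N V ^ N l), of norm at most 2 |l|; so lambda - V has
   no bounded inverse.  When |lambda| <> 1, lambda - V is bounded below by
   | |lambda| - 1 |, and it is onto by a contraction argument applied to V or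
   to V^-1. *)
Require Import Defs.
From HB Require Import structures.
From mathcomp Require Import all_boot all_order all_algebra.
From mathcomp Require Import complex.
From mathcomp Require Import all_classical all_reals all_analysis.
Set Implicit Arguments.
Unset Strict Implicit.
Unset Printing Implicit Defensive.
Import Order.TTheory GRing.Theory Num.Theory.
Import numFieldNormedType.Exports.
Local Open Scope classical_set_scope.
Local Open Scope ring_scope.
Local Open Scope complex_scope.

(** The order hypotheses force [q], [a] and [e] to be real, so the claim descends to [R], where
    geometric sequences tend to 0. *)
Lemma complex_expr_mul_le (R : realType) (q a e : R[i]) :
  0 <= q < 1 -> 0 <= a -> 0 < e -> exists n, q ^+ n * a <= e.
Proof.
move=> /andP[q0 q1] a0 e0.
have [q' qE] := complex_realP _ (ger0_real q0).
have [a' aE] := complex_realP _ (ger0_real a0).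
have [e' eE] := complex_realP _ (gtr0_real e0).
move: q0 q1 a0 e0; rewrite {}qE {}aE {}eE lecR !ltcR lecR => q0 q1 a0 e0.
have /cvgrPdist_lt/(_ e' e0)[n _ /(_ n (leqnn n))] :=
  @cvg_geometric R a' q' (ltac:(by rewrite ger0_norm)).
rewrite /= sub0r normrN => /ltW le_e; exists n.
rewrite -rmorphXn -rmorphM lecR mulrC.
exact: le_trans (ler_norm _) le_e.
Qed.

Lemma complex_nat_unbounded (R : realType) (c : R[i]) :
  c \is Num.real -> exists n : nat, c < n%:R.
Proof.
move=> /complex_realP[c' ->]; exists (Num.truncn c').+1.
by rewrite -(rmorph_nat (real_complex R)) ltcR truncnS_gt.
Qed.

Section operators.
Context (R : realType) (Y : completeNormedModType R[i]).
Implicit Types (x y : Y) (T V : Y -> Y).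

Lemma contraction_fixpoint (f : Y -> Y) (q : R[i]) : 0 <= q < 1 ->
  (forall x y, `|f x - f y| <= q * `|x - y|) -> exists p, f p = p.
Proof.
move=> /andP[q0 q1] fq; pose y n := iter n f 0.
have stepD n : `|y n.+1 - y n| <= q ^+ n * `|f 0|.
  elim: n => [|n ih]; first by rewrite /= expr0 mul1r subr0.
  by rewrite exprS -mulrA (le_trans (fq _ _))// ler_wpM2l.
have y_cauchy : cauchy_ex (y @ \oo).
  move=> e e0.
  (* The contraction shrinks the radius [e / 2] to [q * (e / 2)]; the rest, [(1 - q) * (e / 2)],
     bounds how far [f] may move the centre [y n]. *)
  have [n n_small] : exists n, q ^+ n * `|f 0| <= (1 - q) * (e / 2).
    apply: complex_expr_mul_le => //; first by rewrite q0.
    by rewrite mulr_gt0 ?subr_gt0// divr_gt0.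
  (* f maps the closed ball of radius e / 2 around y n into itself. *)
  have in_ball k : `|y (n + k)%N - y n| <= e / 2.
    elim: k => [|k ih]; first by rewrite addn0 subrr normr0 ltW// divr_gt0.
    rewrite addnS (le_trans (ler_distD (y n.+1) _ _))//.
    rewrite [leRHS](_ : _ = q * (e / 2) + (1 - q) * (e / 2)); last first.
      by rewrite -mulrDl subrKC mul1r.
    apply: lerD; first by rewrite (le_trans (fq _ _))// ler_wpM2l.
    exact: le_trans (stepD n) n_small.
  exists (y n), n => // m nm.
  rewrite /= -ball_normE /= distrC -(subnKC nm) (le_lt_trans (in_ball _))//.
  by rewrite ltr_pdivrMr// ltr_pMr// ltr1n.
have /cvg_ex[p yp] : cvg (y @ \oo) by apply/cauchy_cvgP/cauchy_exP.
exists p; apply/eqP; rewrite -subr_eq0 -normr_le0; apply/ler_addgt0Pl => e e0.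
rewrite addr0.
have /cvgrPdist_lt/(_ (e / 2))[|n _ yn] := yp; first by rewrite divr_gt0.
(* Both [f p] and [p] lie within [e / 2] of [y n.+1 = f (y n)]. *)
rewrite (le_trans (ler_distD (y n.+1) _ _))// [e in leRHS](splitr e) lerD//; last first.
  by rewrite distrC ltW// yn//=.
rewrite (le_trans (fq _ _))// (le_trans (ler_piMl _ (ltW q1)))//.
by rewrite ltW// yn//=.
Qed.

(** The lower bound makes [T] injective and bounds its inverse by [c^-1]. *)
Lemma bounded_below_boundedly_invertible T (c : R[i]) : linear T -> 0 < c ->
  (forall x, c * `|x| <= `|T x|) -> (forall y, exists x, T x = y) ->
  boundedly_invertible T.
Proof.
move=> Tlin c0 Tc /choice[S ST].
have Tinj : injective T.
  move=> x y Txy; apply/eqP; rewrite -subr_eq0 -normr_le0.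
  rewrite -(pmulr_rle0 _ c0) (le_trans (Tc _))//.
  by rewrite (zmod_morphism_linear Tlin) Txy subrr normr0.
have Slin : linear S by move=> a x y; apply: Tinj; rewrite Tlin !ST.
pose SL : {linear Y -> Y} := HB.pack S (GRing.isLinear.Build _ _ _ _ S Slin).
exists SL; split; last exact: ST.
  apply/linear_bounded_continuous/linear_boundedP.
  exists c^-1; split; first by rewrite gtr0_real// invr_gt0.
  move=> r /ltW cr x; rewrite (@le_trans _ _ (c^-1 * `|x|))// ?ler_wpM2r//.
  by rewrite ler_pdivlMl// (le_trans (Tc _))// ST.
by move=> x; apply: Tinj; rewrite ST.
Qed.

Lemma linear_fun0 T : linear T -> T 0 = 0.
Proof. by move=> /zmod_morphism_linear/(_ 0 0); rewrite !subrr. Qed.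

(** An isometry is injective, so the partial inverse used in [zpow] is a genuine two-sided
    inverse. *)
Lemma zpowN1K V : surjective_linear_isometry V ->
  cancel (zpow V (-1)) V /\ cancel V (zpow V (-1)).
Proof.
move=> [Vlin Viso Vsurj].
split=> x /=; first by apply: (surjpK _ Vsurj); rewrite inE.
apply: pinvKV; rewrite ?inE// => u v _ _ uv; apply/eqP.
by rewrite -subr_eq0 -normr_eq0 -Viso (zmod_morphism_linear Vlin) uv subrr normr0.
Qed.

Lemma zpow_linear V n : surjective_linear_isometry V -> linear (zpow V n).
Proof.
move=> Vsli; have [Vlin _ _] := Vsli; have [WK VK] := zpowN1K Vsli.
have Wlin : linear (zpow V (-1)).
  by move=> a x y; apply: (can_inj VK); rewrite Vlin !WK.
case: n => n a x y /=.
  by elim: n => //= n ->; rewrite Vlin.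
elim: n => [|n ih]; first exact: Wlin.
by rewrite iterS ih; exact: Wlin.
Qed.

Lemma spectrum_isometry_sub V (lambda : R[i]) : surjective_linear_isometry V ->
  spectrum V lambda -> `|lambda| = 1.
Proof.
move=> Vsli; have [Vlin Viso _] := Vsli; have [WK VK] := zpowN1K Vsli.
apply: contra_notP => /eqP lambda1.
have Wdist x y : `|zpow V (-1) x - zpow V (-1) y| = `|x - y|.
  by rewrite -Viso (zmod_morphism_linear Vlin) !WK.
apply: (@bounded_below_boundedly_invertible _ `| `|lambda| - 1 |).
- move=> a x y; rewrite Vlin scalerDr opprD addrACA.
  by rewrite scalerA mulrC -scalerA -scalerBr.
- by rewrite normr_gt0 subr_eq0.
- move=> x; rewrite -[X in _ * X]ger0_norm// -normrM mulrBl mul1r -normrZ.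
  by rewrite -[X in _ - X]Viso ler_dist_dist.
(* Solutions of [lambda *: x - V x = y] are fixed points of a map contracting by [|lambda|] when
   [|lambda| < 1], and of another contracting by [|lambda|^-1] when [|lambda| > 1]. *)
move=> y; have := lambda1; rewrite real_neqr_lt ?normr_real// => /orP[lt1|gt1].
- have [|u v|p pE] := @contraction_fixpoint (fun x => zpow V (-1) (lambda *: x - y)) `|lambda|.
  + by rewrite normr_ge0.
  + by rewrite Wdist opprB addrA subrK -scalerBr normrZ.
  + by exists p; rewrite -{2}pE WK opprB addrC subrK.
have l0 : lambda != 0 by rewrite -normr_gt0 (lt_trans _ gt1).
have [|u v|p pE] := @contraction_fixpoint (fun x => lambda^-1 *: (y + V x)) `|lambda|^-1.
- by rewrite invr_ge0 normr_ge0 invf_lt1// normr_gt0.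
- rewrite -scalerBr normrZ normfV opprD addrACA subrr add0r.
  by rewrite -(zmod_morphism_linear Vlin) Viso.
by exists p; rewrite -{1}pE scalerA mulfV// scale1r addrK.
Qed.

(** By linearity, one uniquely expandable vector makes every convergent expansion unique; a finite
    sum certainly converges. *)
Lemma unique_series_span_finite V (I : set Y) (e : nat -> int) (l : nat -> Y) N :
  surjective_linear_isometry V -> closed_subspace I ->
  unique_series_span V I e !=set0 ->
  (forall n, I (l n)) -> (forall n, (N <= n)%N -> l n = 0) ->
  unique_series_span V I e (\sum_(0 <= n < N) zpow V (e n) (l n)).
Proof.
move=> Vsli [I0 Ilin _] [y0 [l0 [[l0I l0y0] l0uniq]]] lI lN.
have Zlin n := zpow_linear (e n) Vsli.
have ZD n : {morph zpow V (e n) : x y / x + y}.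
  by move=> x y; rewrite -{1}[x]scale1r Zlin scale1r.
have ID x y : I x -> I y -> I (x + y) by rewrite -{2}[x]scale1r; exact: Ilin.
have IB x y : I x -> I y -> I (x - y).
  by move=> Ix Iy; rewrite addrC -scaleN1r; apply: Ilin.
have lcvg : series (fun n => zpow V (e n) (l n)) @ \oo -->
    \sum_(0 <= n < N) zpow V (e n) (l n).
  apply: cvg_near_cst; exists N => // m /= Nm.
  rewrite /series/= (big_cat_nat _ (n := N))//= [X in _ + X]big1_seq ?addr0//.
  move=> i /andP[_]; rewrite mem_index_iota => /andP[Ni _].
  by rewrite lN// linear_fun0.
exists l; split=> // l' [l'I l's].
(* Shifting the unique expansion of y0 by an expansion of 0 does not change it. *)
have /l0uniq l0E : (forall n, I (l0 n + (l' n - l n))) /\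
    series (fun n => zpow V (e n) (l0 n + (l' n - l n))) @ \oo --> y0.
  split=> [n|]; first by apply: ID => //; exact: IB.
  rewrite [X in X @ _ --> _](_ : _ = series (fun n => zpow V (e n) (l0 n)) +
      (series (fun n => zpow V (e n) (l' n)) - series (fun n => zpow V (e n) (l n)))); last first.
    apply/funext => m; rewrite !fctE /series/= -sumrB -big_split/=.
    by apply: eq_bigr => i _; rewrite ZD (zmod_morphism_linear (Zlin i)).
  rewrite -[y0]addr0 -(subrr (\sum_(0 <= n < N) zpow V (e n) (l n))).
  by apply: cvgD => //; apply: cvgB.
apply/funext => n; have /esym/eqP := congr1 (@^~ n) l0E.
by rewrite -subr_eq0 /= [X in X - _]addrC addrK subr_eq0 => /eqP.
Qed.

Lemma norm_wandering_sum V (I : set Y) (l : Y) (mu : R[i]) N :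
  surjective_linear_isometry V -> closed_subspace I -> I l -> `|mu| = 1 ->
  forward_sum V I !=set0 -> backward_sum V I !=set0 ->
  (forall w1 w2, forward_sum V I w1 -> backward_sum V I w2 ->
    `|w1 + w2| = sqrtC (`|w1| ^+ 2 + `|w2| ^+ 2)) ->
  `|\sum_(0 <= n < N) mu ^+ n *: iter n V l| ^+ 2 = N%:R * `|l| ^+ 2.
Proof.
move=> Vsli Isub Il mu1 fwd0 bwd0 pyth; have [Vlin Viso _] := Vsli.
have [WK VK] := zpowN1K Vsli; have [I0 Ilin _] := Isub.
have IZ a x : I x -> I (a *: x) by move=> Ix; rewrite -[_ *: _]addr0; exact: Ilin.
have VnZ n a x : iter n V (a *: x) = a *: iter n V x.
  by elim: n => //= n ->; rewrite (scalable_linear Vlin).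
elim: N => [|N ih]; first by rewrite big_geq// normr0 expr0n mul0r.
set x := \sum_(0 <= n < N) _ in ih.
(* Pulling out [V] sends the term of index 0 to the backward side, so the Pythagorean identity adds
   one [|l| ^+ 2] per induction step. *)
have -> : \sum_(0 <= n < N.+1) mu ^+ n *: iter n V l = V (mu *: x + zpow V (-1) l).
  rewrite Vlin WK addrC big_nat_recl// expr0 scale1r; congr (_ + _).
  rewrite /x (@big_morph _ _ V 0 +%R 0 +%R) ?(linear_fun0 Vlin)//; last first.
    by move=> u v; rewrite -[u]scale1r Vlin !scale1r.
  rewrite scaler_sumr; apply: eq_bigr => i _.
  by rewrite (scalable_linear Vlin) scalerA exprS.
have fwd : forward_sum V I (mu *: x).
  rewrite /x scaler_sumr.
  rewrite [X in _ _ _ X](_ : _ = \sum_(0 <= n < N)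
      zpow V n%:Z (if (n < N)%N then mu ^+ n.+1 *: l else 0)); last first.
    apply: eq_big_nat => i /andP[_ ->].
    by rewrite scalerA -exprS /= VnZ.
  apply: unique_series_span_finite => // n; first by case: ifP => // _; exact: IZ.
  by rewrite leqNgt => /negbTE ->.
have bwd : backward_sum V I (zpow V (-1) l).
  (* Index 0 of a backward sum carries the power -1, so the coefficients are [l, 0, 0, ...]. *)
  rewrite [X in _ _ _ X](_ : _ = \sum_(0 <= n < 1)
      zpow V (- n.+1%:Z) (if n == 0%N then l else 0)); last by rewrite big_nat1.
  by apply: unique_series_span_finite => // -[|n].
rewrite Viso pyth// sqrtCK normrZ mu1 mul1r ih.
rewrite -[`|zpow _ _ _|]Viso WK.
by rewrite -natr1 mulrDl mul1r.
Qed.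

(** If [I] had no nonzero vector, all series over [I] would vanish, and with them the whole
    space. *)
Lemma sigma_shift_wandering_neq0 V (I : set Y) :
  surjective_linear_isometry V -> (exists x : Y, x != 0) ->
  [set w1 + w2 | w1 in forward_sum V I & w2 in backward_sum V I] = [set: Y] ->
  exists2 l, I l & l != 0.
Proof.
move=> Vsli [x x0] decomp; apply: contrapT => /forall2NP I0.
have span0 e w : unique_series_span V I e w -> w = 0.
  move=> [l [[lI lw] _]]; apply: (cvg_unique _ lw) => //.
  apply: cvg_near_cst; apply: nearW => n; rewrite /series/= big1// => i _.
  have -> : l i = 0 by have [//|/negP] := I0 (l i); rewrite negbK => /eqP.
  by rewrite (linear_fun0 (zpow_linear _ Vsli)).
have : [set: Y] x by [].
rewrite -decomp => -[w1 /span0 -> [w2 /span0 ->]]; rewrite addr0 => x0'.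
by rewrite -x0' eqxx in x0.
Qed.

Lemma sigma_shift_spectrum V (lambda : R[i]) : (exists x : Y, x != 0) ->
  sigma_shift V -> `|lambda| = 1 -> spectrum V lambda.
Proof.
move=> Y0 [Vsli [I [Isub [_ _ decomp pyth]]]] lambda1 [S [Scont SK _]].
have [l Il l0] := sigma_shift_wandering_neq0 Vsli Y0 decomp.
have [fwd0 bwd0] : forward_sum V I !=set0 /\ backward_sum V I !=set0.
  have : [set: Y] 0 by [].
  by rewrite -decomp => -[w1 w1F [w2 w2B _]]; split; [exists w1|exists w2].
have [Vlin Viso _] := Vsli.
have lambda0 : lambda != 0 by rewrite -normr_gt0 lambda1.
have mu1 : `|lambda^-1| = 1 by rewrite normfV lambda1 invr1.
have [c c0 Sc] : exists2 c, 0 < c & forall x, `|S x| <= c * `|x|.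
  exact/pinfty_ex_gt0/linear_boundedP/linear_bounded_continuous.
have Viter n : `|iter n V l| = `|l| by elim: n => //= n <-.
pose x N := \sum_(0 <= n < N) lambda^-1 ^+ n *: iter n V l.
(* [V] of each term equals [lambda] times the next term, so only the two end terms survive. *)
have xN N : `|lambda *: x N - V (x N)| <= `|l| *+ 2.
  have -> : lambda *: x N - V (x N) =
      lambda *: (l - lambda^-1 ^+ N *: iter N V l).
    rewrite /x; elim: N => [|N ih].
      by rewrite big_geq// scaler0 sub0r expr0 scale1r subrr scaler0
        linear_fun0// oppr0.
    rewrite big_nat_recr//= [in V _]addrC Vlin [X in _ - X]addrC.
    rewrite scalerDr opprD addrACA ih !scalerBr addrA subrK.
    by rewrite [in RHS]scalerA exprS mulrA mulfV// mul1r.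
  rewrite normrZ lambda1 mul1r (le_trans (ler_normB _ _))//.
  by rewrite normrZ normrX mu1 expr1n mul1r Viter -mulr2n.
(* Boundedness of [S] gives [N * |l| ^ 2 = |x N| ^ 2 <= (2 * c * |l|) ^ 2], which fails once [N]
   exceeds [(c * 2) ^+ 2]. *)
have c_real : (c * 2) ^+ 2 \is Num.real by rewrite realX// gtr0_real// mulr_gt0.
have [N] := complex_nat_unbounded c_real.
apply/negP; rewrite -real_leNgt ?realn//.
rewrite -(ler_pM2r (_ : 0 < `|l| ^+ 2)) ?exprn_gt0 ?normr_gt0//.
rewrite -(norm_wandering_sum N Vsli Isub Il mu1)// -/(x N) -exprMn.
rewrite ler_sqr ?nnegrE ?mulr_ge0 ?(ltW c0)//.
rewrite -{1}[x N]SK (le_trans (Sc _))// -mulrA ler_wpM2l ?(ltW c0)//.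
by rewrite mulr_natl.
Qed.

End operators.

Theorem proposition6p10 (R : realType) (Y : completeNormedModType R[i])
    (Y_neq0 : exists x : Y, x != 0) (Y_smooth : smooth Y)
    (V : Y -> Y) (V_shift : sigma_shift V) :
  spectrum V = [set lambda : R[i] | `|lambda| = 1].
Proof.
apply/seteqP; split=> lambda; last exact: sigma_shift_spectrum.
by apply: spectrum_isometry_sub; case: V_shift.
Qed.
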